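(* Let $R=(R_{l,l'})_{l,l'\ge 1}$ be an infinite random array of real numbers which is symmetric, non-negative definite and weakly exchangeable, with diagonal elements $R_{l,l}=1$ for all $l\ge 1$. Suppose that the off-diagonal elements take finitely many values, that is, there are an integer $k\ge 1$, numbers $-1\le q_1<q_2<\dots<q_k\le 1$ and $p_1,\dots,p_k>0$ with $p_1+\dots+p_k=1$ such that $$\mathbb{P}(R_{1,2}=q_l)=p_l\quad\text{for } 1\le l\le k.$$ Suppose also that $R$ satisfies the Ghirlanda-Guerra identities: for every $n\ge 2$ and all bounded measurable functions $f=f\bigl((R_{l,l'})_{1\le l,l'\le n}\bigr)$ and $\psi:\mathbb{R}\to\mathbb{R}$, $$\mathbb{E} f\,\psi(R_{1,n+1})=\frac1n\,\mathbb{E} f\;\mathbb{E}\psi(R_{1,2})+\frac1n\sum_{l=2}^{n}\mathbb{E} f\,\psi(R_{1,l}).$$ Then $R$ is ultrametric: $$\mathbb{P}\bigl(R_{2,3}\ge \min(R_{1,2},R_{1,3})\bigr)=1.$$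
   Context: An infinite random array $R=(R_{l,l'})_{l,l'\ge1}$ is weakly exchangeable if for every $n\ge 1$ and every permutation $\rho$ of $\{1,\dots,n\}$ the matrix $(R_{\rho(l),\rho(l')})_{l,l'\le n}$ has the same distribution as $(R_{l,l'})_{l,l'\le n}$. It is non-negative definite if, with probability one, each matrix $(R_{l,l'})_{l,l'\le n}$, $n\ge1$, is non-negative definite. *)

(* Defs.v *)
From HB Require Import structures.
From mathcomp Require Import all_boot all_order all_algebra all_fingroup.
From mathcomp Require Import all_classical all_reals all_analysis.
Set Implicit Arguments.
Unset Strict Implicit.
Unset Printing Implicit Defensive.
Import Order.TTheory GRing.Theory Num.Theory.
Import numFieldNormedType.Exports.
Local Open Scope classical_set_scope.
Local Open Scope ring_scope.

(* Arrays are indexed by [nat] from 0, so [X l l'] is the (l+1, l'+1) entry of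
   the array indexed from 1. *)
Section arrays.
Context {d : measure_display} {T : measurableType d} {R : realType}
  {P : probability T R}.
Implicit Type X : nat -> nat -> {RV P >-> R}.

(* A random n x n matrix is a map into [n.-tuple (n.-tuple R)], the type on
   which the library provides the product sigma-algebra. *)
Definition subarray X n (s : 'I_n -> nat) (t : T) : n.-tuple (n.-tuple R) :=
  [tuple [tuple X (s i) (s j) t | j < n] | i < n].

Lemma measurable_subarray X n (s : 'I_n -> nat) :
  measurable_fun [set: T] (subarray X s).
Proof.
apply/measurable_fun_tnthP => i; apply/measurable_fun_tnthP => j.
rewrite (_ : _ \o _ = X (s i) (s j)); first exact: measurable_funPT.
by apply/funext => t; rewrite /= !tnth_mktuple.
Qed.

HB.instance Definition _ X n (s : 'I_n -> nat) :=
  isMeasurableFun.Build _ _ _ _ (subarray X s) (measurable_subarray X s).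

Definition block X n : {RV P >-> n.-tuple (n.-tuple R)} :=
  subarray X (@nat_of_ord n).

Definition permuted_block X n (rho : 'S_n) :
  {RV P >-> n.-tuple (n.-tuple R)} := subarray X (fun i => rho i : nat).

Definition symmetric_array X :=
  {ae P, forall t, forall l l', X l l' t = X l' l t}.

Definition nonneg_definite n (A : 'M[R]_n) :=
  forall v : 'cV[R]_n, 0 <= (v^T *m A *m v) 0 0.

Definition nonneg_definite_array X :=
  {ae P, forall t, forall n, nonneg_definite (\matrix_(i < n, j < n) X i j t)}.

Definition unit_diagonal X := {ae P, forall t, forall l, X l l t = 1}.

(* [distribution P Z] is a function on all sets, of which only the values on
   measurable sets are meaningful. *)
Definition weakly_exchangeable X :=
  forall n (rho : 'S_n) (A : set (n.-tuple (n.-tuple R))), measurable A ->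
    distribution P (permuted_block X rho) A = distribution P (block X n) A.

Local Open Scope ereal_scope.

Definition ghirlanda_guerra X :=
  forall n, (2 <= n)%N ->
  forall (f : n.-tuple (n.-tuple R) -> R) (psi : R -> R),
    measurable_fun [set: n.-tuple (n.-tuple R)] f -> bounded_fun f ->
    measurable_fun [set: R] psi -> bounded_fun psi ->
  'E_P[(fun t => f (block X n t) * psi (X 0%N n t))%R] =
    (n%:R^-1)%:E * ('E_P[f \o block X n] * 'E_P[psi \o X 0%N 1%N]) +
    (n%:R^-1)%:E *
      \sum_(1 <= l < n) 'E_P[(fun t => f (block X n t) * psi (X 0%N l t))%R].

End arrays.

(* Main.v *)
Require Import Defs.
From HB Require Import structures.
From mathcomp Require Import all_boot all_order all_algebra all_fingroup.
From mathcomp Require Import all_classical all_reals all_analysis.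
From mathcomp Require Import measurable_realfun ring lra zify.
Set Implicit Arguments.
Unset Strict Implicit.
Unset Printing Implicit Defensive.
Import Order.TTheory GRing.Theory Num.Theory.
Import numFieldNormedType.Exports.
Local Open Scope classical_set_scope.
Local Open Scope ring_scope.

(** Suppose that with positive probability three points [y], [z], [x] satisfy
    [y.z = b], [y.x = a], [z.x = c] with [c < a <= b], where the dot stands for
    the entry of the array.  The contradiction comes from adding many further
    copies of [y] and of [z] without losing positivity of the probability.

    Duplication ([duplication]).  Let [n >= 2] points realize a pattern of
    relations with positive probability, and let [b] bound the entries between
    the first point and the others.  Then with positive probability there is one
    more point that stands in the same relations as the first one to all the
    others, and whose entry with the first one is again at most [b].  Call a
    point outside the pattern a copy if it has the relations of the first point
    with the others.  If the claim fails, a new point with entry at most [b] with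
    the first one is almost surely not a copy.  By the Ghirlanda-Guerra identities,
    given [N] points whose entries with the first one do not exceed [b], the entry
    of the next point with the first one exceeds [b] with conditional probability
    at most [1 / N] ([ghirlanda_guerra_le]).  So the entries of the next [j] points
    with the first one all stay at most [b] with probability at least of order
    [1 / j] ([harmonic_avoidance]), and then none of these [j] points is a copy.
    By exchangeability, exchanging the first point with the new point [N + j]
    turns this event into the event that [N + j] is the earliest copy among the
    new points.  These events are disjoint for distinct [j] while the harmonic
    series diverges ([trivIset_harmonic_le0]).

    Geometry ([spread_bound]).  Iterating, one obtains with positive probability
    [M] copies of [y] with mutual entries at most [b], [M] copies of [z] with
    mutual entries at most [b], with entries [b] between both families, and
    entries [a], respectively [c], with the same point [x].  In a Hilbert space
    both barycenters would be at distance [O(M^(-1/2))], but their scalar products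
    with the unit vector [x] differ by [a - c].  In terms of the array,
    non-negative definiteness tested on one vector gives
    [M * (a - c) ^+ 2 <= 2 * (1 - b)], which fails for large [M].

    Since [X 0 1] takes finitely many values, a violation of the ultrametric
    inequality of positive probability puts positive probability on such an exact
    triple. *)

(** * Cylinder sets of arrays *)

Section cylinders.
Context {R : realType}.
Implicit Types (N : nat) (Phi Psi : set (nat -> nat -> R)).

(** The default value 0 outside the block makes [entry M] a total array, so that
    one predicate on infinite arrays can be evaluated on blocks of any size. *)
Definition entry N (M : N.-tuple (N.-tuple R)) (i j : nat) : R :=
  nth 0 (nth [tuple 0 | _ < N] M i) j.

Lemma measurable_entry N i j :
  measurable_fun setT (fun M : N.-tuple (N.-tuple R) => entry M i j).
Proof.
have [iN|Ni] := ltnP i N; last first.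
  apply: (eq_measurable_fun (cst ([tuple 0 | _ < N]`_j : R))) => [M _|].
    by rewrite /entry (nth_default _ (s := M)) ?size_tuple.
  exact: measurable_cst.
have [jN|Nj] := ltnP j N; last first.
  apply: (eq_measurable_fun (cst (0 : R))) => [M _|]; last exact: measurable_cst.
  by rewrite /entry nth_default ?size_tuple.
apply: (eq_measurable_fun ((fun v : N.-tuple R => tnth v (Ordinal jN)) \o
    (fun M : N.-tuple (N.-tuple R) => tnth M (Ordinal iN)))) => [M _|].
  by rewrite /= (tnth_nth 0) (tnth_nth [tuple 0 | _ < N]).
by apply: measurableT_comp; exact: measurable_tnth.
Qed.

(** An event about the entries of index less than [N] only.  The second conjunct
    is what allows one to evaluate [Phi] on the random array or on any of its
    blocks of size at least [N]. *)
Definition cylinder N Phi :=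
  measurable [set M : N.-tuple (N.-tuple R) | Phi (entry M)] /\
  (forall a b, (forall i j, (i < N)%N -> (j < N)%N -> a i j = b i j) ->
     Phi a -> Phi b).

Lemma cylinder_entry N i j (S : set R) : (i < N)%N -> (j < N)%N ->
  measurable S -> cylinder N [set a | S (a i j)].
Proof.
move=> iN jN mS; split=> [|a b ab /=]; last by rewrite ab.
have := @measurable_entry N i j measurableT S mS.
by rewrite setTI.
Qed.

Lemma cylinderI N Phi Psi :
  cylinder N Phi -> cylinder N Psi -> cylinder N (Phi `&` Psi).
Proof.
move=> [mA hA] [mB hB]; split; first exact: measurableI mA mB.
by move=> a b ab [/(hA _ _ ab) ? /(hB _ _ ab)].
Qed.

Lemma cylinderC N Phi : cylinder N Phi -> cylinder N (~` Phi).
Proof.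
move=> [mA hA]; split; first exact: measurableC mA.
by move=> a b ab nA /hA B; apply/nA/B => i j iN jN; rewrite ab.
Qed.

Lemma cylinder_bigcap N (D : set nat) (Phi : nat -> set (nat -> nat -> R)) :
  (forall i, D i -> cylinder N (Phi i)) ->
  cylinder N (\bigcap_(i in D) Phi i).
Proof.
move=> h; split; last first.
  by move=> a b ab hA i Di; have [_ /(_ a b ab)] := h i Di; apply; exact: hA.
rewrite (_ : [set _ | _] =
   \bigcap_(i in D) [set M : N.-tuple (N.-tuple R) | Phi i (entry M)]) //.
by apply: bigcap_measurableType => i /h [].
Qed.

Lemma cylinder_forall2 N (D : nat -> nat -> Prop)
    (Phi : nat -> nat -> set (nat -> nat -> R)) :
  (forall i j, D i j -> cylinder N (Phi i j)) ->
  cylinder N [set u | forall i j, D i j -> Phi i j u].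
Proof.
move=> h; rewrite (_ : [set u | _] =
    \bigcap_(i in setT) \bigcap_(j in D i) Phi i j).
  by apply: cylinder_bigcap => i _; apply: cylinder_bigcap => j /h.
by apply/seteqP; split=> [u hu i _ j /hu|u hu i j Dij]; [|exact: hu Dij].
Qed.

Lemma cylinderW N N' Phi : (N <= N')%N -> cylinder N Phi -> cylinder N' Phi.
Proof.
move=> NN' [mA hA]; split; last first.
  move=> a b ab; apply: hA => i j iN jN; apply: ab; exact: leq_trans NN'.
pose g (M : N'.-tuple (N'.-tuple R)) : N.-tuple (N.-tuple R) :=
  [tuple [tuple entry M i j | j < N] | i < N].
have mg : measurable_fun setT g.
  apply/measurable_fun_tnthP => i; apply/measurable_fun_tnthP => j.
  rewrite (_ : _ \o _ = fun M => entry M i j); first exact: measurable_entry.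
  by apply/funext => M; rewrite /= !tnth_mktuple.
have := mg measurableT _ mA; rewrite setTI; congr (measurable _).
have gE M i j : (i < N)%N -> (j < N)%N -> entry (g M) i j = entry M i j.
  move=> iN jN; rewrite /entry -(tnth_nth _ (g M) (Ordinal iN)) tnth_mktuple.
  by rewrite -(tnth_nth _ _ (Ordinal jN)) tnth_mktuple.
apply/seteqP; split => M /=; apply: hA => i j iN jN; by rewrite gE.
Qed.

End cylinders.

(** * Consequences of exchangeability and of the Ghirlanda-Guerra identities *)

Section arrays.
Context {d : measure_display} {T : measurableType d} {R : realType}
  {P : probability T R}.
Variable X : nat -> nat -> {RV P >-> R}.
Implicit Types (N : nat) (Phi Psi : set (nat -> nat -> R)).

Definition array (t : T) (i j : nat) : R := X i j t.

Lemma entry_subarray N (s : 'I_N -> nat) (t : T) i j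
    (iN : (i < N)%N) (jN : (j < N)%N) :
  entry (subarray X s t) i j = X (s (Ordinal iN)) (s (Ordinal jN)) t.
Proof.
rewrite /entry -(tnth_nth _ _ (Ordinal iN)) tnth_mktuple.
by rewrite -(tnth_nth _ _ (Ordinal jN)) tnth_mktuple.
Qed.

Lemma cylinder_block N Phi : cylinder N Phi ->
  array @^-1` Phi = block X N @^-1` [set M | Phi (entry M)].
Proof.
move=> [_ hPhi]; apply/seteqP; split => t /=; apply: hPhi => i j iN jN;
  by rewrite entry_subarray.
Qed.

Lemma measurable_array N Phi : cylinder N Phi -> measurable (array @^-1` Phi).
Proof.
move=> cPhi; rewrite (cylinder_block cPhi) -[X in measurable X]setTI.
by case: cPhi => m _; exact: measurable_funPT.
Qed.

Definition swap (a b i : nat) := if i == a then b else if i == b then a else i.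

(** Transpositions of [nat], rather than permutations of a block, let [Phi] keep
    its index set [nat], whatever the size of the block that it depends on. *)
Lemma law_swap N a b Phi : weakly_exchangeable X -> (a < N)%N -> (b < N)%N ->
  cylinder N Phi ->
  P (array @^-1` [set u | Phi (fun i j => u (swap a b i) (swap a b j))]) =
  P (array @^-1` Phi).
Proof.
move=> hX aN bN cPhi.
rewrite (cylinder_block cPhi).
have [m hPhi] := cPhi.
rewrite -[RHS](hX N (tperm (Ordinal aN) (Ordinal bN)) _ m).
rewrite /distribution /pushforward.
congr (P _); apply/seteqP.
have E (i : 'I_N) : (tperm (Ordinal aN) (Ordinal bN) i : nat) = swap a b i.
  rewrite /swap; case: tpermP => [->|->|/eqP + /eqP] /=; rewrite ?eqxx //.
    by case: eqP => [->|].
  by rewrite -!val_eqE /= => /negbTE -> /negbTE ->.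
split => t /=; apply: hPhi => i j iN jN;
  by rewrite entry_subarray !E.
Qed.

(** When [Phi] forbids all the entries [u 0 l] already present to lie in [S], the
    sum in the identity vanishes; what remains is [P Phi * P (X 0 1 \in S) / n]. *)
Lemma ghirlanda_guerra_le n Phi (S : set R) : ghirlanda_guerra X -> (2 <= n)%N ->
  cylinder n Phi -> measurable S ->
  (forall l u, (0 < l < n)%N -> Phi u -> ~ S (u 0%N l)) ->
  (P (array @^-1` (Phi `&` [set u | S (u 0%N n)])) <=
   (n%:R^-1)%:E * P (array @^-1` Phi))%E.
Proof.
move=> hG n2 cPhi mS hS.
have [m _] := cPhi.
have mPhi := measurable_array cPhi.
have mSX l : measurable (X 0%N l @^-1` S).
  by rewrite -[X in measurable X]setTI; exact: measurable_funPT.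
have bI (U : Type) (B : set U) : bounded_fun (\1_B : U -> R).
  exists 1; split=> // r r1 x _ /=; rewrite indicE.
  by case: (x \in B); rewrite ?normr1 ?normr0; lra.
have indE l : (fun t => \1_[set M | Phi (entry M)] (block X n t) *
    \1_S (X 0%N l t)) = \1_(array @^-1` Phi `&` X 0%N l @^-1` S) :> (T -> R).
  rewrite (cylinder_block cPhi); apply/funext => t.
  by rewrite indicI /= !indicE.
have := hG n n2 (\1_[set M | Phi (entry M)]) (\1_S) _ (bI _ _) _ (bI _ _).
move=> /(_ (measurable_indic m) (measurable_indic mS)).
rewrite indE big1_seq; last first.
  move=> l /andP[_]; rewrite mem_index_iota => ln.
  rewrite indE (_ : _ `&` _ = set0) ?expectation_indic ?measure0//.
  apply/seteqP; split=> // t [/= Pt St]; exact: (hS l (array t)).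
rewrite (_ : \1__ \o _ = \1_(array @^-1` Phi)); last first.
  by rewrite (cylinder_block cPhi); apply/funext => t /=; rewrite !indicE.
rewrite (_ : \1_S \o _ = \1_(X 0%N 1%N @^-1` S)); last first.
  by apply/funext => t /=; rewrite !indicE.
rewrite mule0 adde0 !expectation_indic //; last exact: measurableI.
move=> ->; apply: lee_wpmul2l; first by rewrite lee_fin invr_ge0 ler0n.
by rewrite -[leRHS]mule1 lee_wpmul2l// probability_le1.
Qed.

(** The harmonic series diverges, whereas disjoint events have total probability
    at most one. *)
Lemma trivIset_harmonic_le0 (F : nat -> set T) (c : R) :
  (forall j, measurable (F j)) -> trivIset setT F ->
  (forall j, (c / j.+1%:R)%:E <= P (F j))%E -> c <= 0.
Proof.
move=> mF tF hF; rewrite leNgt; apply/negP => c0.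
apply: (@dvg_harmonic R); apply: nondecreasing_is_cvgn.
  by apply: nondecreasing_series => n _ _; rewrite invr_ge0 ler0n.
exists c^-1 => _ [n _ <-].
rewrite -[leRHS]mul1r ler_pdivlMr// mulr_suml /= big_mkord.
rewrite -lee_fin (le_trans _ (@probability_le1 _ _ _ P
  (\big[setU/set0]_(i < n) F i) _))//; last exact: bigsetU_measurable.
rewrite measure_semi_additive_ord_I //; last 2 first.
  exact: sub_trivIset tF.
  exact: bigsetU_measurable.
rewrite -sumEFin; apply: lee_sum => i _.
by rewrite mulrC; exact: hF.
Qed.

(** One step of the induction costs a factor at least
    [1 - (N + j)^-1 >= (j + 1) / (j + 2)], as [N >= 2]; the product of these
    factors telescopes. *)
Lemma harmonic_avoidance N Phi (b : R) : ghirlanda_guerra X -> (2 <= N)%N ->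
  cylinder N Phi -> (forall u, Phi u -> forall l, (0 < l < N)%N -> u 0%N l <= b) ->
  forall j, ((fine (P (array @^-1` Phi)) / j.+1%:R)%:E <=
    P (array @^-1`
      (Phi `&` [set u | forall i, (i < j)%N -> (u 0%N (N + i)%N <= b)%R])))%E.
Proof.
move=> hG N2 cPhi hb.
pose H j := Phi `&` [set u : nat -> nat -> R |
  forall i, (i < j)%N -> u 0%N (N + i)%N <= b].
have mgt : measurable [set r : R | b < r].
  by rewrite -set_itvoy; exact: measurable_itv.
have cH j : cylinder (N + j) (H j).
  apply: cylinderI; first by apply: cylinderW cPhi; rewrite leq_addr.
  apply: cylinder_bigcap => i /= ij.
  apply: (@cylinder_entry _ _ _ _ [set r : R | r <= b]); [lia|lia|].
  by rewrite -set_itvNyc; exact: measurable_itv.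
suff : forall j, ((fine (P (array @^-1` Phi)) / j.+1%:R)%:E <=
  P (array @^-1` H j))%E by [].
elim=> [|j IHj].
  rewrite divr1 fineK ?fin_num_measure//; last exact: measurable_array cPhi.
  rewrite (_ : H 0%N = Phi) // /H; apply/seteqP; split=> [u []//|u Pu]; by split.
have mH := measurable_array (cH _).
have new : (P (array @^-1` (H j `&` [set u | (b < u 0%N (N + j)%N)%R])) <=
    ((N + j)%:R^-1)%:E * P (array @^-1` H j))%E.
  apply: (@ghirlanda_guerra_le _ _ [set r : R | b < r]) => //; first lia.
  move=> l u lN [Phu Hu] /=; apply/negP; rewrite -leNgt.
  have [lN'|Nl] := ltnP l N; first by apply: hb => //; lia.
  by rewrite -(subnKC Nl); apply: Hu; lia.
have split_H : P (array @^-1` H j) = (P (array @^-1` H j.+1) +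
    P (array @^-1` (H j `&` [set u | (b < u 0%N (N + j)%N)%R])))%E.
  rewrite -measureU //.
  - congr (P _); apply/seteqP; split=> [t [Pt Ht]|t /= [[Pt Ht]|[]//]].
      have [le_b|gt_b] := lerP (X 0%N (N + j)%N t) b; [left|by right].
      split=> // i; rewrite ltnS leq_eqVlt => /predU1P[->//|]; exact: Ht.
    by split=> // i ij; apply: Ht; apply: ltnW.
  - apply: (@measurable_array (N + j).+1); apply: cylinderI.
      by apply: cylinderW (cH j).
    by apply: (@cylinder_entry _ _ _ _ [set r : R | b < r]); [lia|lia|].
  - apply/seteqP; split=> // t [[_ /(_ j (ltnSn j)) /= le_b] [_ /=]].
    by rewrite ltNge le_b.
move: IHj new split_H.
have fH i : P (array @^-1` H i) \is a fin_num by rewrite fin_num_measure.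
rewrite -(fineK (fH j)) -(fineK (fH j.+1)).
set n := P (array @^-1` (_ `&` _)).
have fn : n \is a fin_num.
  rewrite fin_num_measure //; apply: (@measurable_array (N + j).+1).
  apply: cylinderI; first by apply: cylinderW (cH j).
  by apply: (@cylinder_entry _ _ _ _ [set r : R | b < r]); [lia|lia|].
rewrite -(fineK fn) -EFinM -EFinD !lee_fin => IHj new [split_H].
set c := fine (P (array @^-1` Phi)) in IHj *.
set x := fine (P (array @^-1` H j)) in IHj new split_H *.
set y := fine (P (array @^-1` H j.+1)) in split_H *.
set z := fine n in new split_H.
have x0 : 0 <= x by exact: fine_ge0.
have {}new : z <= j.+2%:R^-1 * x.
  apply: le_trans new _; apply: ler_wpM2r => //.
  by rewrite lef_pV2 ?posrE ?ltr0n ?ler_nat; lia.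
rewrite ler_pdivrMr ?ltr0n//.
rewrite ler_pdivrMr ?ltr0n// in IHj.
rewrite mulrC ler_pdivlMr ?ltr0n// in new.
have -> : y = x - z by rewrite split_H addrK.
have e : j.+2%:R = j.+1%:R + 1 :> R by rewrite -addn1 natrD.
by rewrite mulrBl; move: IHj new; rewrite e !mulrDr !mulr1; lra.
Qed.

End arrays.

(** * Duplicating a point of a pattern *)

Section duplication.
Context {d : measure_display} {T : measurableType d} {R : realType}
  {P : probability T R}.
Variable X : nat -> nat -> {RV P >-> R}.
Context {L : Type}.
Variable B : L -> L -> set R.
Hypothesis mB : forall l l', measurable (B l l').

(** Point [i] carries the label [lam i], and [B] tells which entries are allowed
    between two labels.  Both orders of a pair are constrained, so that patterns
    are stable under relabelling without symmetry of the array. *)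
Definition pattern (lam : nat -> L) N : set (nat -> nat -> R) :=
  [set u | forall i j, [/\ i < N, j < N & i != j]%N ->
     B (lam i) (lam j) (u i j)].

Lemma cylinder_pattern lam N : cylinder N (pattern lam N).
Proof.
by apply: cylinder_forall2 => i j [iN jN _]; exact: cylinder_entry.
Qed.

Lemma pattern_swap lam N a b : weakly_exchangeable X -> (a < N)%N -> (b < N)%N ->
  P (array X @^-1` pattern lam N) =
  P (array X @^-1` pattern (fun i => lam (swap a b i)) N).
Proof.
move=> hX aN bN.
have swapK i : swap a b (swap a b i) = i.
  by rewrite /swap; do ?case: eqP => //; lia.
have swapN i : (i < N)%N -> (swap a b i < N)%N.
  by rewrite /swap; do ?case: eqP => //; lia.
have swap_inj i j : (swap a b i == swap a b j) = (i == j).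
  by apply: inj_eq; exact: can_inj swapK.
rewrite -(law_swap hX aN bN (cylinder_pattern _ _)).
congr (P _); apply/seteqP; split=> t /= h i j [iN jN ij];
  have := h (swap a b i) (swap a b j); rewrite /array !swapK; apply;
  by rewrite swap_inj !swapN.
Qed.

(** The first point plays the role of the point to be copied because the
    Ghirlanda-Guerra identities are stated for the first row.  Its copy is put at
    the end, at index [N]. *)
Lemma duplication (lam : nat -> L) N (b : R) :
  symmetric_array X -> weakly_exchangeable X -> ghirlanda_guerra X ->
  (2 <= N)%N -> lam N = lam 0%N ->
  (forall i r, (0 < i < N)%N -> B (lam 0%N) (lam i) r -> r <= b) ->
  (forall r, r <= b -> B (lam 0%N) (lam 0%N) r) ->
  (0 < P (array X @^-1` pattern lam N))%E ->
  (0 < P (array X @^-1` pattern lam N.+1))%E.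
Proof.
move=> hsym hX hG N2 lamN hb hB pN.
rewrite lt0e measure_ge0 andbT; apply/negP => /eqP p0.
(* [core] concerns the points other than the first one; [copy k] says that [k] is
   related to them as the first point should be. *)
pose core : set (nat -> nat -> R) :=
  [set u | forall i j, [/\ (0 < i < N), (0 < j < N) & i != j]%N ->
     B (lam i) (lam j) (u i j)].
pose copy k : set (nat -> nat -> R) := [set u | forall i, (0 < i < N)%N ->
  B (lam i) (lam 0%N) (u i k) /\ B (lam 0%N) (lam i) (u k i)].
have c_core M : (N <= M)%N -> cylinder M core.
  move=> NM; apply: cylinder_forall2 => i j [iN jN _].
  by apply: cylinder_entry => //; lia.
have c_copy k M : (N <= M)%N -> (k < M)%N -> cylinder M (copy k).
  move=> NM kM; apply: cylinder_bigcap => i iN.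
  rewrite /= in iN.
  by apply: cylinderI; apply: cylinder_entry => //; lia.
pose base := core `&` copy 0%N.
have c_base M : (N <= M)%N -> cylinder M base.
  by move=> NM; apply: cylinderI; [exact: c_core|apply: c_copy => //; lia].
have baseE : base = pattern lam N.
  apply/seteqP; split=> u.
    move=> [h1 h2] i j [iN jN ij].
    have [i0|i0] := posnP i; have [j0|j0] := posnP j.
    - by move: ij; rewrite i0 j0.
    - by rewrite i0; have [] := h2 j; rewrite ?j0.
    - by rewrite j0; have [] := h2 i; rewrite ?i0.
    - by apply: h1; rewrite i0 j0.
  move=> h; split=> [i j [iN jN ij]|i iN]; first by apply: h; split=> //; lia.
  by split; apply: h; split; lia.
(* [first_copy j]: the point [N + j] is the earliest copy among the points of
   index at least [N].  Exchanging it with the first point gives [only_copy j]. *)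
pose first_copy j := core `&` copy (N + j)%N `&`
  \bigcap_(i in [set i | i < j]%N) ~` copy (N + i)%N.
pose only_copy j := base `&`
  \bigcap_(i in [set i | i < j]%N) ~` copy (N + i)%N.
have c_none j :
    cylinder (N + j) (\bigcap_(i in [set i | i < j]%N) ~` copy (N + i)%N).
  by apply: cylinder_bigcap => i /= ij; apply/cylinderC/c_copy; lia.
have c_first j : cylinder (N + j).+1 (first_copy j).
  apply: cylinderI; last by apply: cylinderW (c_none j).
  by apply: cylinderI; [apply: c_core|apply: c_copy]; lia.
have coreE s u : (forall i, (0 < i < N)%N -> s i = i) ->
    core (fun i k => u (s i) (s k)) <-> core u.
  move=> hs; split=> h i k [iN kN ik]; have := h i k;
    by rewrite (hs i iN) (hs k kN); apply.
have copyE s k u : (forall i, (0 < i < N)%N -> s i = i) ->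
    copy k (fun i l => u (s i) (s l)) <-> copy (s k) u.
  by move=> hs; split=> h i iN; have := h i iN; rewrite (hs i iN).
have P_first j : P (array X @^-1` first_copy j) = P (array X @^-1` only_copy j).
  rewrite -(law_swap hX (ltn0Sn _) (ltnSn _) (c_first j)).
  congr (P _).
  have sw i : (0 < i < N)%N -> swap 0 (N + j) i = i.
    by rewrite /swap; do ?case: eqP => //; lia.
  have sw0 : swap 0 (N + j) (N + j) = 0%N.
    by rewrite /swap; do ?case: eqP => //; lia.
  have swi i : (i < j)%N -> swap 0 (N + j) (N + i) = (N + i)%N.
    by rewrite /swap; do ?case: eqP => //; lia.
  apply/seteqP; split=> t /=.
    move=> [[/(coreE _ _ sw) h1 /(copyE _ _ _ sw)]]; rewrite sw0 => h2 h3.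
    by split=> // i ij h4; apply: (h3 i ij); apply/(copyE _ _ _ sw); rewrite swi.
  move=> [[h1 h2] h3].
  split; first by split; [exact/(coreE _ _ sw)|apply/(copyE _ _ _ sw); rewrite sw0].
  by move=> i ij /(copyE _ _ _ sw); rewrite swi//; exact: h3.
(* A copy with entry at most [b] completes the pattern on [N.+1] points, hence is
   almost surely absent. *)
pose close i := base `&` copy (N + i)%N `&` [set u | u 0%N (N + i)%N <= b].
have mle : measurable [set r : R | r <= b].
  by rewrite -set_itvNyc; exact: measurable_itv.
have c_close i : cylinder (N + i).+1 (close i).
  apply: cylinderI; first by apply: cylinderI; [apply: c_base|apply: c_copy]; lia.
  by apply: (@cylinder_entry _ _ _ _ [set r : R | r <= b]); [lia|lia|].
have close00 : P (array X @^-1` close 0%N) = 0%E.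
  have m_pat := measurable_array X (cylinder_pattern lam N.+1).
  apply: measure_negligible; first exact: (measurable_array X (c_close _)).
  have pN0 : P.-negligible (array X @^-1` pattern lam N.+1).
    exact/negligibleP.
  apply: negligibleS (negligibleU pN0 hsym) => t [[ht h3] h4].
  have [sym|nsym] := pselect (forall l l', X l l' t = X l' l t); last by right.
  left=> k l; rewrite baseE in ht; rewrite /= addn0 in h3 h4.
  have inN k' : (k' < N.+1)%N -> [\/ k' = N, k' = 0%N | (0 < k' < N)%N].
    move=> k'N; have [->|k0] := posnP k'; first by constructor 2.
    by case: (ltngtP k' N) => kN; [constructor 3|lia|constructor 1].
  move=> -[/inN kN /inN lN]; rewrite /array.
  case: kN => [->|->|kN]; case: lN => [->|->|lN]; rewrite ?lamN ?eqxx// => kl.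
  - by rewrite sym; exact: hB.
  - by have [] := h3 l lN.
  - exact: hB.
  - by apply: (ht 0%N l); split=> //; lia.
  - by have [] := h3 k kN.
  - by apply: (ht k 0%N); split=> //; lia.
  - by apply: (ht k l); split=> //; lia.
have close0 i : P (array X @^-1` close i) = 0%E.
  have NNi : (N < (N + i).+1)%N by lia.
  rewrite -(law_swap hX NNi (ltnSn _) (c_close i)) -close00.
  have sw l : (l < N)%N -> swap N (N + i) l = l.
    by rewrite /swap; do ?case: eqP => //; lia.
  have sw' l : (0 < l < N)%N -> swap N (N + i) l = l by move=> lN; apply: sw; lia.
  have swN : swap N (N + i) (N + i) = N.
    by rewrite /swap; do ?case: eqP => //; lia.
  have sw0 : swap N (N + i) 0 = 0%N by apply: sw; lia.
  congr (P _); apply/seteqP; split=> t /=.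
    move=> [[[/(coreE _ _ sw') h1 /(copyE _ _ _ sw') h2] /(copyE _ _ _ sw') h3]].
    by rewrite /= swN sw0 => h4; rewrite swN in h3; rewrite sw0 in h2;
      split; rewrite /= addn0.
  move=> [[[h1 h2] h3] /= h4]; rewrite addn0 in h3 h4.
  split; last by rewrite /= swN sw0.
  split; last by apply/(copyE _ _ _ sw'); rewrite swN.
  by split; [exact/(coreE _ _ sw')|apply/(copyE _ _ _ sw'); rewrite sw0].
(* On [H j], none of the [j] new points is a copy, up to a null event: this is
   the inclusion of [H j] in [only_copy j] modulo [Z] below. *)
pose H j := base `&` [set u : nat -> nat -> R |
  forall i, (i < j)%N -> u 0%N (N + i)%N <= b].
have lower j : (P (array X @^-1` H j) <= P (array X @^-1` first_copy j))%E.
  pose Z := \bigcup_i (array X @^-1` close i).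
  have mZ : measurable Z.
    by apply: bigcup_measurable => i _; exact: (measurable_array X (c_close i)).
  have Z0 : P Z = 0%E.
    apply: measure_negligible => //; apply: negligible_bigcup => i.
    by apply/negligibleP; [exact: (measurable_array X (c_close i))|exact: close0].
  have m_only : measurable (array X @^-1` only_copy j).
    apply: (@measurable_array _ _ _ _ X (N + j)%N).
    by apply: cylinderI (c_none j); apply: c_base; lia.
  rewrite P_first -(measureU0 m_only mZ Z0).
  apply: le_measure; rewrite ?inE.
  - apply: (@measurable_array _ _ _ _ X (N + j)%N); apply: cylinderI.
      by apply: c_base; lia.
    apply: cylinder_bigcap => i /= ij.
    by apply: (@cylinder_entry _ _ _ _ [set r : R | r <= b]); [lia|lia|].
  - exact: measurableU.
  - move=> t [Bt Ht].
    have [[i ci]|nc] := pselect (exists i, (i < j)%N /\ copy (N + i)%N (array X t)).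
      by right; exists i => //; split; [split; tauto|apply: Ht; tauto].
    by left; split=> // i /= ij ci; apply: nc; exists i.
have : fine (P (array X @^-1` base)) <= 0.
  apply: (@trivIset_harmonic_le0 _ _ _ P (fun j => array X @^-1` first_copy j)).
  - by move=> j; exact: (measurable_array X (c_first j)).
  - apply/trivIsetP => i j _ _; wlog ij : i j / (i < j)%N.
      move=> W ij; have [lt_ij|lt_ji] : (i < j)%N \/ (j < i)%N by lia.
        exact: W.
      by rewrite setIC; apply: W; rewrite // eq_sym.
    move=> _; apply/seteqP; split=> // t [[[_ h] _] [_ /(_ i ij)]]; exact.
  - move=> j; apply: le_trans (lower j).
    apply: harmonic_avoidance => //; first exact: c_base.
    move=> u [_ hu] l lN; have [_] := hu l lN; exact: hb.
rewrite leNgt => /negP; apply.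
rewrite baseE fine_gt0// pN ltey_eq fin_num_measure//.
exact: (measurable_array X (cylinder_pattern _ _)).
Qed.

End duplication.

(** * A large spread-out configuration contradicts non-negative definiteness *)

Local Notation apex := (@None bool).
Local Notation lft := (Some true).
Local Notation rgt := (Some false).

Section triangle.
Context {R : realType}.
Variables a b c : R.

(** The label [apex] belongs to the single point [x], the labels [lft] and [rgt] to
    the copies of [y] and [z].  The value [b] on the diagonal is not the
    diagonal of the array but the bound on the entries between distinct copies. *)
Definition triangle (l l' : option bool) : R :=
  match l, l' with
  | None, Some true | Some true, None => a
  | None, Some false | Some false, None => c
  | _, _ => b
  end.

Definition triangle_rel (l l' : option bool) : set R :=
  if l == l' then [set r | r <= b] else [set r | r = triangle l l'].

Lemma measurable_triangle l l' : measurable (triangle_rel l l').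
Proof.
rewrite /triangle_rel; case: ifP => _; last exact: measurable_set1.
by rewrite -set_itvNyc; exact: measurable_itv.
Qed.

(** Products of weights of equal labels are squares, so for them the bound [b] on
    the entries can be used in the quadratic form; the diagonal entries are 1
    instead of [b], which accounts for the second sum. *)
Lemma quadratic_form_le (s : seq (option bool)) (u : nat -> nat -> R)
    (w : option bool -> R) :
  pattern triangle_rel (nth apex s) (size s) u -> (forall i, u i i = 1) ->
  nonneg_definite (\matrix_(i < size s, j < size s) u i j) ->
  0 <= \sum_(l <- s) \sum_(l' <- s) w l * w l' * triangle l l' +
       \sum_(l <- s) w l ^+ 2 * (1 - b).
Proof.
move=> hu u1 /(_ (\col_i w (nth apex s i))) /le_trans; apply.
rewrite (big_nth apex) big_mkord (big_nth apex) big_mkord -big_split /=.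
rewrite [leLHS](_ : _ = \sum_(i < size s) \sum_(j < size s)
    w (nth apex s i) * w (nth apex s j) * u i j); last first.
  rewrite mxE [RHS]exchange_big /=; apply: eq_bigr => j _.
  by rewrite !mxE mulr_suml; apply: eq_bigr => i _; rewrite !mxE mulrAC.
apply: ler_sum => i _.
rewrite (big_nth apex) big_mkord (bigD1 i) //= [X in _ <= X + _](bigD1 i) //=.
rewrite u1 (_ : triangle _ _ = b); last by case: (nth _ _ _) => [[]|].
rewrite -subr_ge0 [X in 0 <= X](_ : _ =
  \sum_(j < size s | j != i) w (nth apex s i) * w (nth apex s j) *
    triangle (nth apex s i) (nth apex s j) -
  \sum_(j < size s | j != i) w (nth apex s i) * w (nth apex s j) * u i j);
  last by ring.
rewrite subr_ge0; apply: ler_sum => j ji.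
have := hu i j; rewrite eq_sym in ji; move/(_ (And3 (ltn_ord i) (ltn_ord j) ji)).
rewrite /triangle_rel; case: ifP => [/eqP <-|_ -> //] /= u_b.
rewrite (_ : triangle _ _ = b); last by case: (nth _ _ _) => [[]|].
by rewrite ler_wpM2l// -expr2 sqr_ge0.
Qed.

Lemma spread_bound m (u : nat -> nat -> R) :
  let s := [:: rgt, lft, apex & nseq m lft ++ nseq m rgt] in
  pattern triangle_rel (nth apex s) (size s) u -> (forall i, u i i = 1) ->
  nonneg_definite (\matrix_(i < size s, j < size s) u i j) ->
  m.+1%:R * (a - c) ^+ 2 <= 2 * (1 - b).
Proof.
move=> s hu u1 hnn.
pose M : R := m.+1%:R.
(* With [M] points of each side the form is [K^2 - 2 K M (a - c) + 2 M (1 - b)]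
   in the weight [K] of the apex; it is minimal at [K = M (a - c)]. *)
pose w l : R := match l with
  | None => M * (a - c) | Some true => -1 | Some false => 1 end.
have /= := quadratic_form_le w hu u1 hnn.
have sumE (g : option bool -> R) :
    \sum_(l <- s) g l = M * g lft + M * g rgt + g apex.
  rewrite /s !big_cons big_cat /= !big_nseq !iter_addr_0 /M.
  by rewrite -!(mulr_natl (g _)) -natr1; ring.
rewrite !sumE /= => h.
have M0 : 0 < M by rewrite ltr0n.
rewrite -(ler_pM2l M0) -subr_ge0; apply: le_trans h _.
by rewrite le_eqVlt; apply/orP; left; apply/eqP; rewrite -/M; ring.
Qed.

End triangle.

(** * Ultrametricity *)

Section ultrametric.
Context {d : measure_display} {T : measurableType d} {R : realType}
  {P : probability T R}.
Variable X : nat -> nat -> {RV P >-> R}.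
Hypotheses (hsym : symmetric_array X) (hX : weakly_exchangeable X)
  (hG : ghirlanda_guerra X).

Lemma duplication_iter (L : Type) (B : L -> L -> set R) (y x0 : L)
    (s : seq L) (b : R) m :
  (forall l l', measurable (B l l')) ->
  (forall l r, B y l r -> r <= b) ->
  (forall r, r <= b -> B y y r) -> (0 < size s)%N ->
  (0 < P (array X @^-1` pattern B (nth x0 (y :: s)) (size s).+1))%E ->
  (0 < P (array X @^-1`
     pattern B (nth x0 (y :: s ++ nseq m y)) (size s + m).+1))%E.
Proof.
move=> mB hb hB s0 h.
have nthE i : (i <= size s)%N -> nth x0 (y :: s ++ nseq m y) i = nth x0 (y :: s) i.
  by move=> iS; rewrite -cat_cons nth_cat /= ltnS iS.
have patE (lam lam' : nat -> L) N : (forall i, (i < N)%N -> lam i = lam' i) ->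
    pattern B lam N `<=` pattern B lam' N.
  by move=> e u hu i j [iN jN ij]; rewrite -!e //; apply: hu.
suff : forall k, (k <= m)%N -> (0 < P (array X @^-1`
  pattern B (nth x0 (y :: s ++ nseq m y)) (size s + k).+1))%E by apply.
elim=> [_|k IHk km].
  rewrite addn0; congr (0 < P _)%E: h; congr (_ @^-1` _).
  by apply/seteqP; split; apply: patE => i iS; rewrite nthE.
rewrite addnS; apply: (@duplication _ _ _ _ X L B mB _ _ b) => //;
  [lia| | |exact: IHk (ltnW km)].
  by rewrite /= nth_cat ltnNge leq_addr /= addKn nth_nseq km.
by move=> i r _; exact: hb.
Qed.

(** Both [lft] and [rgt] have all their prescribed entries at most [b], because
    [c < a <= b]; so each can be duplicated [m] times, [rgt] after being moved to
    the first place. *)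
Lemma bad_triangle_null (a b c : R) : nonneg_definite_array X -> unit_diagonal X ->
  a <= b -> c < a ->
  P (array X @^-1` pattern (triangle_rel a b c) (nth apex [:: lft; rgt; apex]) 3)
    = 0%E.
Proof.
move=> hnnd hdiag ab ca; apply/eqP; rewrite -measure_le0 leNgt; apply/negP => p0.
pose m := Num.trunc (2 * (1 - b) / (a - c) ^+ 2).
have mT := @measurable_triangle R a b c.
pose s := [:: rgt, lft, apex & nseq m lft ++ nseq m rgt].
pose spread := array X @^-1` pattern (triangle_rel a b c) (nth apex s) (size s).
have ps : (0 < P spread)%E.
  have leP l r : l != apex -> forall l', triangle_rel a b c l l' r -> r <= b.
    case: l => // l _ l'; rewrite /triangle_rel; case: ifP => // _ /= ->.
    by case: l l' => [] [[]|] //=; lra.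
  have diagP l r : r <= b -> triangle_rel a b c l l r.
    by rewrite /triangle_rel eqxx.
  have copies l s' : l != apex -> (0 < size s')%N ->
      (0 < P (array X @^-1` pattern (triangle_rel a b c) (nth apex (l :: s'))
        (size s').+1))%E ->
      (0 < P (array X @^-1` pattern (triangle_rel a b c)
        (nth apex (l :: s' ++ nseq m l)) (size s' + m).+1))%E.
    move=> la s0; apply: (@duplication_iter _ _ _ _ s' b m mT _ _ s0) => // l' r;
      [exact: leP|exact: diagP].
  have {p0} := copies lft [:: rgt; apex] isT isT p0.
  rewrite (@pattern_swap _ _ _ _ X _ _ mT _ _ 0 1 hX) // => p0.
  have := copies rgt [:: lft, apex & nseq m lft] isT isT.
  rewrite /spread /s /= !size_cat !size_nseq !addSn.
  apply; congr (0 < P (_ @^-1` pattern _ _ _))%E: p0.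
  by apply/funext => -[|[|[|i]]].
pose nnd t := forall n, nonneg_definite (\matrix_(i < n, j < n) X i j t).
have [t [[ht nn] diag]] :
    exists t, (spread `&` [set t | nnd t] `&` [set t | forall l, X l l t = 1]) t.
  apply: contrapT => h; have : P.-negligible spread.
    apply: negligibleS (negligibleU hnnd hdiag) => t ht.
    have [nn|] := pselect (nnd t); last by left.
    have [dg|] := pselect (forall l, X l l t = 1); last by right.
    by exfalso; apply: h; exists t.
  move/negligibleP => /(_ (measurable_array X (cylinder_pattern mT _ _))) e.
  by rewrite e ltxx in ps.
have := spread_bound ht diag (nn (size s)).
apply/negP; rewrite -ltNge.
rewrite -ltr_pdivrMr; last by rewrite exprn_gt0// subr_gt0.
exact: truncnS_gt.
Qed.

(** The corner 0 common to the two large entries is one of the two points to be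
    duplicated; the other one is the corner that has the larger entry with it. *)
Lemma triple_negligible (x y z : R) : nonneg_definite_array X -> unit_diagonal X ->
  z < x -> z < y ->
  P.-negligible [set t | [/\ X 0%N 1%N t = x, X 0%N 2%N t = y & X 1%N 2%N t = z]].
Proof.
move=> hnnd hdiag zx zy.
suff [a [b [c [lam [p0 pat]]]]] : exists a b c, exists lam : nat -> option bool,
    P (array X @^-1` pattern (triangle_rel a b c) lam 3) = 0%E /\
    triangle_rel a b c (lam 0%N) (lam 1%N) x /\
    triangle_rel a b c (lam 0%N) (lam 2%N) y /\
    triangle_rel a b c (lam 1%N) (lam 2%N) z.
  have patN : P.-negligible (array X @^-1` pattern (triangle_rel a b c) lam 3).
    apply/negligibleP => //; apply: (measurable_array X (cylinder_pattern _ _ _)).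
    exact: measurable_triangle.
  apply: negligibleS (negligibleU patN hsym) => t [ex ey ez].
  have [sym|nsym] := pselect (forall l l', X l l' t = X l' l t); last by right.
  have relC l l' r : triangle_rel a b c l l' r -> triangle_rel a b c l' l r.
    rewrite /triangle_rel eq_sym; case: eqP => // _ ->.
    by case: l l' => [[]|] [[]|].
  case: pat => pxy [pxz pyz].
  left=> -[|[|[|i]]] [|[|[|j]]] [//= _ _ _]; rewrite /array.
  - by rewrite ex.
  - by rewrite ey.
  - by rewrite sym ex; exact: relC.
  - by rewrite ez.
  - by rewrite sym ey; exact: relC.
  - by rewrite sym ez; exact: relC.
have [xy|yx] := leP x y.
- exists x, y, z, (fun i => nth apex [:: lft; rgt; apex] (swap 1 2 i)).
  rewrite -pattern_swap ?bad_triangle_null //; exact: measurable_triangle.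
- exists y, x, z, (nth apex [:: lft; rgt; apex]).
  by rewrite bad_triangle_null // ltW.
Qed.

(** By exchangeability these entries have the same law as [X 0 1]. *)
Lemma entry_negligible (S : set R) : measurable S ->
  P.-negligible (X 0%N 1%N @^-1` S) ->
  P.-negligible (X 0%N 2%N @^-1` S) /\ P.-negligible (X 1%N 2%N @^-1` S).
Proof.
move=> mS.
have c i j : (i < 3)%N -> (j < 3)%N -> cylinder 3 [set u | S (u i j)].
  by move=> i3 j3; exact: cylinder_entry.
have mX i j : measurable (X i j @^-1` S).
  by rewrite -[X in measurable X]setTI; exact: measurable_funPT.
move/negligibleP => /(_ (mX _ _)) e01.
have e02 : P (X 0%N 2%N @^-1` S) = 0%E.
  rewrite -e01; exact: (@law_swap _ _ _ _ X 3 1 2 _ hX isT isT (c 0%N 1%N isT isT)).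
have e12 : P (X 1%N 2%N @^-1` S) = 0%E.
  rewrite -e02; exact: (@law_swap _ _ _ _ X 3 0 1 _ hX isT isT (c 0%N 2%N isT isT)).
by split; apply/negligibleP.
Qed.

End ultrametric.

Theorem theorem1 (d : measure_display) (T : measurableType d) (R : realType)
    (P : probability T R) (X : nat -> nat -> {RV P >-> R})
    (hsym : symmetric_array X) (hnnd : nonneg_definite_array X)
    (hexch : weakly_exchangeable X) (hdiag : unit_diagonal X)
    (k : nat) (hk : (1 <= k)%N) (q p : 'I_k -> R)
    (hq : forall i, -1 <= q i <= 1)
    (hq_incr : forall i j : 'I_k, (i < j)%N -> q i < q j)
    (hp : forall i, 0 < p i) (hp1 : \sum_(i < k) p i = 1)
    (hlaw : forall l, P [set t | X 0%N 1%N t = q l] = (p l)%:E)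
    (hGG : ghirlanda_guerra X) :
  P [set t | Num.min (X 0%N 1%N t) (X 0%N 2%N t) <= X 1%N 2%N t] = 1%E.
Proof.
pose S : set R := \big[setU/set0]_(i < k) [set q i].
have mS : measurable S by apply: bigsetU_measurable => i _; exact: measurable_set1.
have SP r : S r -> exists i, r = q i.
  rewrite /S; elim/big_ind: _ => // [A B hA hB [/hA|/hB]//|i _ ->].
  by exists i.
have q_inj : injective q.
  move=> i j; case: (ltngtP i j) => [/hq_incr|/hq_incr|/val_inj//];
    by move=> /[swap] ->; rewrite ltxx.
have mX i j (A : set R) : measurable A -> measurable (X i j @^-1` A).
  by move=> mA; rewrite -[X in measurable X]setTI; exact: measurable_funPT.
have PS : P (X 0%N 1%N @^-1` S) = 1%E.
  rewrite /S (big_morph (preimage (X 0%N 1%N)) (preimage_setU _) (preimage_set0 _)).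
  rewrite measure_semi_additive_ord.
  - rewrite (eq_bigr (fun i => (p i)%:E)) ?sumEFin ?hp1// => i _; exact: hlaw.
  - by move=> i; apply: mX; exact: measurable_set1.
  - apply/trivIsetP => i j _ _ ij; apply/seteqP; split=> // t [/= -> /q_inj].
    by move/eqP; rewrite (negbTE ij).
  - by apply: bigsetU_measurable => i _; apply: mX; exact: measurable_set1.
have nS : P.-negligible (X 0%N 1%N @^-1` ~` S).
  have nS0 : P (X 0%N 1%N @^-1` ~` S) = 0%E.
    by rewrite preimage_setC probability_setC ?PS ?subee//; exact: mX.
  by apply/negligibleP => //; apply: mX; exact: measurableC.
have [nS02 nS12] := entry_negligible hexch (measurableC mS) nS.
pose bad := [set t | X 1%N 2%N t < Num.min (X 0%N 1%N t) (X 0%N 2%N t)].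
have nbad : P.-negligible bad.
  pose U (i : 'I_k * 'I_k * 'I_k) := [set t |
     [/\ X 0%N 1%N t = q i.1.1, X 0%N 2%N t = q i.1.2 & X 1%N 2%N t = q i.2]] `&` bad.
  have nU i : P.-negligible (U i).
    have [lt_q|ge_q] := boolP ((q i.2 < q i.1.1) && (q i.2 < q i.1.2)).
      have /andP[lt1 lt2] := lt_q.
      apply: negligibleS (triple_negligible hsym hexch hGG hnnd hdiag lt1 lt2).
      by move=> t [].
    apply: negligibleS (negligible_set0 P) => t [[e1 e2 e3]].
    by rewrite /bad /= lt_min e1 e2 e3 (negbTE ge_q).
  have nbig : P.-negligible (\big[setU/set0]_i U i).
    elim/big_ind: _ => //; first exact: negligible_set0.
    by move=> A B; exact: negligibleU.
  apply: negligibleS (negligibleU (negligibleU nS nS02) (negligibleU nS12 nbig)).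
  move=> t bt.
  have [/SP[i ei]|] := pselect (S (X 0%N 1%N t)); last by left; left.
  have [/SP[j ej]|] := pselect (S (X 0%N 2%N t)); last by left; right.
  have [/SP[l el]|] := pselect (S (X 1%N 2%N t)); last by right; left.
  by right; right; rewrite (bigD1 (i, j, l)) //=; left.
rewrite (_ : [set t | _] = ~` bad); last first.
  by apply/seteqP; split=> t /=; rewrite leNgt => /negP.
have mbad : measurable bad.
  have mb : measurable_fun setT
      (fun t => X 1%N 2%N t < Num.min (X 0%N 1%N t) (X 0%N 2%N t)).
    by apply: measurable_fun_ltr => //; exact: measurable_minr.
  by have := mb measurableT [set true] I; rewrite setTI.
rewrite probability_setC //.
by move/negligibleP: nbad => ->//; rewrite sube0.
Qed.
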